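(* Let $1<p\le 2$, and let $\psi$ be a positive measurable function on $\mathbb{R}^N$ satisfying $$M_\psi:=\sup_{t>0}\, t\int_{\{\xi\in\mathbb{R}^N:\ \psi(\xi)\ge t\}} d\mu_{k,a}(\xi)<\infty .$$ Then for every $f\in L^p_{k,a}(\mathbb{R}^N)$, $$\left(\int_{\mathbb{R}^N}|\mathcal{F}_{k,a}f(\xi)|^p\,\psi(\xi)^{2-p}\,d\mu_{k,a}(\xi)\right)^{1/p}\le C\, M_\psi^{\frac{2-p}{p}}\,\|f\|_{L^p_{k,a}(\mathbb{R}^N)},$$ where $C>0$ is a constant independent of $f$ and $\psi$.
   Context: Setting. $N\ge1$; $\mathcal{R}\subset\mathbb{R}^N\setminus\{0\}$ is a (reduced) root system with positive subsystem $\mathcal{R}_+$; $r_\alpha$ is the orthogonal reflection in the hyperplane $\alpha^\perp$; $\mathfrak{G}\subset O(N,\mathbb{R})$ is the reflection group generated by the $r_\alpha$, $\alpha\in\mathcal{R}$; $k:\mathcal{R}\to[0,\infty)$, $\alpha\mapsto k_\alpha$, is a $\mathfrak{G}$-invariant function (multiplicity function); $a>0$. $\langle\cdot,\cdot\rangle$ and $\|\cdot\|$ are the Euclidean inner product and norm. Put $\langle k\rangle=\frac12\sum_{\alpha\in\mathcal{R}}k_\alpha$, $v_k(x)=\prod_{\alpha\in\mathcal{R}}|\langle\alpha,x\rangle|^{k_\alpha}$, $v_{k,a}(x)=\|x\|^{a-2}v_k(x)$, $d\mu_{k,a}(x)=v_{k,a}(x)\,dx$, and $L^p_{k,a}(\mathbb{R}^N)=L^p(\mathbb{R}^N,\mu_{k,a})$.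 Dunkl Laplacian. For $\xi\in\mathbb{R}^N$, $T_\xi(k)f(x)=\partial_\xi f(x)+\sum_{\alpha\in\mathcal{R}_+}k_\alpha\langle\alpha,\xi\rangle\frac{f(x)-f(r_\alpha x)}{\langle\alpha,x\rangle}$, and $\Delta_k=\sum_{j=1}^N T_{\xi_j}(k)^2$ for any orthonormal basis $\xi_1,\dots,\xi_N$ of $\mathbb{R}^N$. $(k,a)$-generalised Fourier transform. Let $\Delta_{k,a}=\|x\|^{2-a}\Delta_k-\|x\|^a$ and assume $a+2\langle k\rangle+N-2>0$. Then $$\mathcal{F}_{k,a}=\exp\left[\frac{i\pi}{2}\cdot\frac{2\langle k\rangle+N+a-2}{a}\right]\exp\left[\frac{i\pi}{2a}\Delta_{k,a}\right],$$ a unitary operator on $L^2_{k,a}(\mathbb{R}^N)$. Here the exponential is that of the self-adjoint realisation of $\Delta_{k,a}$ diagonalised by the functions $\Phi(x)=p(x)\,L_\ell^{(\lambda_m)}\!\left(\tfrac2a\|x\|^a\right)e^{-\|x\|^a/a}$, where $\ell,m\in\mathbb{N}_0$, $p$ is a homogeneous polynomial of degree $m$ with $\Delta_kp=0$, $\lambda_m=(2m+2\langle k\rangle+N-2)/a$, and $L_\ell^{(\lambda)}$ are the Laguerre polynomials; these functions span a dense subspace of $L^2_{k,a}(\mathbb{R}^N)$ and $\mathcal{F}_{k,a}\Phi=e^{-i\pi(\ell+m/a)}\Phi$. One has $\mathcal{F}_{k,a}f(\xi)=c_{k,a}\int_{\mathbb{R}^N}B_{k,a}(\xi,x)f(x)\,d\mu_{k,a}(x)$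 with a normalising constant $c_{k,a}$ and a symmetric distribution kernel $B_{k,a}$. Standing assumption. $N\ge1$, $k\ge0$, $a>0$, $a+2\langle k\rangle+N-2>0$, and $B_{k,a}$ is uniformly bounded: $|B_{k,a}(\xi,x)|\le M<\infty$ for all $x,\xi\in\mathbb{R}^N$. (It is known that this boundedness holds if, in addition to $a+2\langle k\rangle+N-2>0$, one of the following holds: $N=1$ and $a>0$; $a=1$ and $2\langle k\rangle+N-2\ge0$; $a=2$; $k=0$ and $a=2/m$ for some $m\in\mathbb{N}$.) Under it $\mathcal{F}_{k,a}$ is defined on $L^1_{k,a}(\mathbb{R}^N)$ by the integral and extends to $L^p_{k,a}(\mathbb{R}^N)$, $1\le p\le2$, by the known Hausdorff-Young inequality $\|\mathcal{F}_{k,a}f\|_{L^{p'}_{k,a}}\le C\|f\|_{L^p_{k,a}}$, $p'=p/(p-1)$. *)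

(* Defs.v *)
From HB Require Import structures.
From mathcomp Require Import all_boot all_order all_algebra.
From mathcomp Require Import finmap.
From mathcomp Require Import complex.
From mathcomp Require Import all_classical all_reals all_analysis.
From mathcomp Require Import measurable_realfun.

Set Implicit Arguments.
Unset Strict Implicit.
Unset Printing Implicit Defensive.

Import Order.TTheory GRing.Theory Num.Theory.
Import numFieldNormedType.Exports.

Local Open Scope classical_set_scope.
Local Open Scope ring_scope.

Definition rV_display : measure_display -> measure_display.
Proof. exact. Qed.

(* The sigma-algebra generated by the coordinates, as the library does for
   n.-tuple R; it is the Borel sigma-algebra of 'rV[R]_n. *)
Section rV_measurable.
Context {R : realType} (n : nat).

Let coor : 'I_n -> 'rV[R]_n -> R := fun i v => v ord0 i.

HB.instance Definition _ :=
  @isMeasurable.Build (rV_display default_measure_display) 'rV[R]_n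
    (g_sigma_preimage coor) (@sigma_algebra0 _ _ _)
    (@sigma_algebraC _ _) (@sigma_algebra_bigcup _ _ _).

Lemma measurable_coor (i : 'I_n) :
  measurable_fun [set: 'rV[R]_n] (fun v : 'rV[R]_n => v ord0 i).
Proof.
move=> _ Y mY; rewrite setTI; apply: sub_sigma_algebra => /=.
rewrite -bigcup_seq/=; exists i => /=; first by rewrite mem_index_enum.
by exists Y => //; rewrite setTI.
Qed.

Lemma measurable_rVP d (T : measurableType d) (f : T -> 'rV[R]_n) :
  (forall i, measurable_fun [set: T] (fun x => f x ord0 i)) ->
  measurable_fun [set: T] f.
Proof.
move=> mf _ Y mY; rewrite setTI.
have : g_sigma_preimage coor Y by [].
apply: (@smallest_sub _ _ _ (fun Y => measurable (f @^-1` Y))).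
  split => /=.
  - by rewrite preimage_set0.
  - by move=> A mA; rewrite setTD preimage_setC; exact: measurableC.
  - by move=> A mA; rewrite preimage_bigcup; exact: bigcup_measurable.
move=> Z /=; rewrite -bigcup_seq/= => -[i _ [W mW <-]].
rewrite setTI -comp_preimage -[X in measurable X]setTI; exact: mf.
Qed.

End rV_measurable.

Section rV_lebesgue.
Context {R : realType}.

Definition rV_cons n (x : measurableTypeR R * 'rV[R]_n) : 'rV[R]_n.+1 :=
  \row_i if unlift ord0 i is Some j then x.2 ord0 j else x.1.

Definition rV_uncons n (v : 'rV[R]_n.+1) : measurableTypeR R * 'rV[R]_n :=
  (v ord0 ord0, \row_j v ord0 (lift ord0 j)).

Lemma rV_consK n : cancel (@rV_cons n) (@rV_uncons n).
Proof.
move=> [x v]; rewrite /rV_uncons /rV_cons mxE unlift_none/=; congr pair.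
by apply/rowP => j; rewrite !mxE liftK.
Qed.

Lemma measurable_rV_cons n : measurable_fun setT (@rV_cons n).
Proof.
apply: measurable_rVP => i; rewrite /rV_cons.
under eq_fun do rewrite mxE.
case: unliftP => [j|] _; last exact: measurable_fst.
by apply: (measurableT_comp (measurable_coor j)); exact: measurable_snd.
Qed.

Lemma measurable_rV_uncons n : measurable_fun setT (@rV_uncons n).
Proof.
apply/measurable_fun_pair => /=; first exact: measurable_coor.
by apply: measurable_rVP => i; under eq_fun do rewrite mxE; exact: measurable_coor.
Qed.

Section step.
Variables (n : nat) (m : {sigma_finite_measure set 'rV[R]_n -> \bar R}).

Definition rV_lebesgue_step (A : set 'rV[R]_n.+1) : \bar R :=
  pushforward (lebesgue_measure \x m)%E (@rV_cons n) A.

Let step0 : rV_lebesgue_step set0 = 0%E.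
Proof. by rewrite /rV_lebesgue_step /pushforward preimage_set0 measure0. Qed.

Let step_ge0 A : (0 <= rV_lebesgue_step A)%E.
Proof. by rewrite /rV_lebesgue_step /pushforward; exact: measure_ge0. Qed.

Let step_sigma_additive : semi_sigma_additive rV_lebesgue_step.
Proof.
move=> F mF tF mUF; rewrite /rV_lebesgue_step /pushforward preimage_bigcup.
have mc (A : set 'rV[R]_n.+1) : measurable A -> measurable (@rV_cons n @^-1` A).
  by move=> mA; rewrite -[X in measurable X]setTI; exact: measurable_rV_cons.
apply: measure_semi_sigma_additive.
- by move=> i; exact: mc.
- apply/trivIsetP => /= i j _ _ ij; rewrite -preimage_setI.
  by move/trivIsetP : tF => /(_ _ _ _ _ ij) ->//; rewrite preimage_set0.
- by rewrite -preimage_bigcup; exact: mc.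
Qed.

HB.instance Definition _ := isMeasure.Build _ _ _ rV_lebesgue_step
  step0 step_ge0 step_sigma_additive.

Let step_sigma_finite : sigma_finite setT rV_lebesgue_step.
Proof.
have /sigma_finiteP[F [TF ndF Foo]] := sigma_finiteT (@lebesgue_measure R).
have /sigma_finiteP[G [TG ndG Goo]] := sigma_finiteT m.
exists (fun i => @rV_uncons n @^-1` (F i `*` G i)).
  apply/esym; rewrite -subTset => v _.
  have [i _ Fi] : (\bigcup_i F i) (rV_uncons v).1 by rewrite -TF.
  have [j _ Gj] : (\bigcup_i G i) (rV_uncons v).2 by rewrite -TG.
  exists (maxn i j) => //; split.
  - by move: Fi; exact/subsetPset/ndF/leq_maxl.
  - by move: Gj; exact/subsetPset/ndG/leq_maxr.
move=> i; have [mF Fy] := Foo i; have [mG Gy] := Goo i; split.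
  rewrite -[X in measurable X]setTI; apply: measurable_rV_uncons => //.
  exact: measurableX.
rewrite /rV_lebesgue_step /pushforward -comp_preimage.
rewrite (_ : _ \o _ = id); last by apply/funext => x; exact: rV_consK.
by rewrite preimage_id product_measure1E// lte_mul_pinfty// ge0_fin_numE.
Qed.

HB.instance Definition _ := Measure_isSigmaFinite.Build _ _ _ rV_lebesgue_step
  step_sigma_finite.

End step.

Fixpoint rV_lebesgue n : {sigma_finite_measure set 'rV[R]_n -> \bar R} :=
  if n is n'.+1 then rV_lebesgue_step (rV_lebesgue n')
  else \d_ (0 : 'rV[R]_0).

Lemma rV_lebesgue_box n (A : 'I_n -> set R) :
  (forall i, measurable (A i)) ->
  rV_lebesgue n [set v | forall i, A i (v ord0 i)] =
  (\prod_(i < n) lebesgue_measure (A i))%E.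
Proof.
have mbox m (B : 'I_m -> set R) : (forall i, measurable (B i)) ->
    measurable [set v : 'rV[R]_m | forall i, B i (v ord0 i)].
  move=> mB; rewrite (_ : mkset _ = \bigcap_(i in [set: 'I_m])
      ((fun v : 'rV[R]_m => v ord0 i) @^-1` B i)); last first.
    by apply/seteqP; split => v /= h j; [move=> _|]; exact: h.
  apply: fin_bigcap_measurable; [exact: finite_finset|move=> j _].
  by rewrite -[X in measurable X]setTI; exact: measurable_coor.
elim: n A => [|n ih] A mA.
  by rewrite big_ord0 /= diracE mem_set// => -[].
rewrite big_ord_recl -(ih (fun j => A (lift ord0 j)))// -product_measure1E//.
  rewrite /= /rV_lebesgue_step /pushforward.
  congr (product_measure1 _ _ _); apply/seteqP; split => -[x v]/=.
    move=> h; split; first by have := h ord0; rewrite mxE unlift_none.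
    by move=> j; have := h (lift ord0 j); rewrite mxE liftK.
  by move=> [hx hv] i; rewrite mxE; case: unliftP => [j|] ->.
  exact: (mA ord0).
exact: (mbox _ (fun j => A (lift ord0 j))).
Qed.

End rV_lebesgue.

Section complex_Lp.
Context {R : realType} d (T : measurableType d).
Variable mu : {measure set T -> \bar R}.

Definition cmeasurable (f : T -> R[i]) : Prop :=
  measurable_fun setT (fun x => complex.Re (f x)) /\
  measurable_fun setT (fun x => complex.Im (f x)).

Definition cLnorm (p : R) (f : T -> R[i]) : \bar R :=
  Lnorm mu p%:E (fun x => (Normc.normc (f x))%:E).

Definition in_Lp (p : R) (f : T -> R[i]) : Prop :=
  cmeasurable f /\ (cLnorm p f < +oo)%E.

Definition cintegral (f : T -> R[i]) : R[i] :=
  Complex (\int[mu]_x complex.Re (f x)) (\int[mu]_x complex.Im (f x)).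

Definition cae_eq (f g : T -> R[i]) : Prop := {ae mu, forall x, f x = g x}.

(* Operators act on functions; as operators on L^p they are determined up to
   almost everywhere equality. *)
Definition linear_on_Lp (p : R) (U : (T -> R[i]) -> (T -> R[i])) : Prop :=
  forall (z : R[i]) (f g : T -> R[i]), in_Lp p f -> in_Lp p g ->
    cae_eq (U (fun x => z * f x + g x)) (fun x => z * U f x + U g x).

Definition unitary_on_L2 (U : (T -> R[i]) -> (T -> R[i])) : Prop :=
  [/\ linear_on_Lp 2 U,
      forall f, in_Lp 2 f -> in_Lp 2 (U f) /\ cLnorm 2 (U f) = cLnorm 2 f
    & forall g, in_Lp 2 g -> exists2 f, in_Lp 2 f & cae_eq (U f) g].

End complex_Lp.

Definition expi {R : realType} (t : R) : R[i] := Complex (cos t) (sin t).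

Section dunkl.
Context {R : realType} {N : nat}.
Local Notation V := 'rV[R]_N.

Definition dotp (x y : V) : R := \sum_(i < N) x ord0 i * y ord0 i.

(* The library norm `|x| on 'rV[R]_N is the sup norm. *)
Definition enorm (x : V) : R := Num.sqrt (dotp x x).

Definition refl (al : V) (x : V) : V :=
  x - (2 * dotp al x / dotp al al) *: al.

Definition is_root_system (Rt : {fset V}) : Prop :=
  [/\ 0 \notin Rt,
      forall al be, al \in Rt -> be \in Rt -> refl al be \in Rt
    & forall al (c : R), al \in Rt -> c *: al \in Rt -> c = 1 \/ c = -1].

Definition is_positive_subsystem (Rt Rp : {fset V}) : Prop :=
  exists be : V, (forall al, al \in Rt -> dotp be al != 0) /\
    (forall al, (al \in Rp) = (al \in Rt) && (0 < dotp be al)).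

(* The generators are involutions, so the monoid they generate is the group. *)
Inductive reflection_group (Rt : {fset V}) : (V -> V) -> Prop :=
| RG_id : reflection_group Rt id
| RG_refl al g : al \in Rt -> reflection_group Rt g ->
    reflection_group Rt (refl al \o g).

Definition is_multiplicity (Rt : {fset V}) (k : V -> R) : Prop :=
  (forall al, al \in Rt -> 0 <= k al) /\
  (forall g al, reflection_group Rt g -> al \in Rt -> k (g al) = k al).

Definition ksum (Rt : {fset V}) (k : V -> R) : R :=
  2^-1 * \sum_(al <- Rt) k al.

Definition regular (Rt : {fset V}) (x : V) : Prop :=
  x != 0 /\ forall al, al \in Rt -> dotp al x != 0.

(* Where dotp al x = 0 the difference quotient is a removable singularity,
   whereas here it is 0 / 0 = 0.  The regular set is open, dense and stable
   under reflections, and T (T f) at a regular point involves T f at regular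
   points only, so the convention is harmless for identities stated on the
   regular set. *)
Definition dunkl_T (Rp : {fset V}) (k : V -> R) (xi : V) (f : V -> R) : V -> R :=
  fun x => 'D_xi f x +
    \sum_(al <- Rp) k al * dotp al xi * ((f x - f (refl al x)) / dotp al x).

Definition dunkl_laplacian (Rp : {fset V}) (k : V -> R) (f : V -> R) : V -> R :=
  fun x => \sum_(j < N)
    dunkl_T Rp k (delta_mx ord0 j) (dunkl_T Rp k (delta_mx ord0 j) f) x.

Definition Delta_ka (Rp : {fset V}) (k : V -> R) (a : R) (f : V -> R) : V -> R :=
  fun x => enorm x `^ (2 - a) * dunkl_laplacian Rp k f x - enorm x `^ a * f x.

Definition is_homog_poly (m : nat) (p : V -> R) : Prop :=
  exists c : {ffun 'I_N -> 'I_m.+1} -> R, forall x,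
    p x = \sum_(s : {ffun 'I_N -> 'I_m.+1} | (\sum_i s i == m)%N)
            c s * \prod_i x ord0 i ^+ s i.

Definition is_dunkl_harmonic (Rt Rp : {fset V}) (k : V -> R) (p : V -> R) : Prop :=
  forall x, regular Rt x -> dunkl_laplacian Rp k p x = 0.

End dunkl.

Definition laguerre {R : realType} (l : nat) (lam : R) (t : R) : R :=
  \sum_(j < l.+1) (-1) ^+ j * (\prod_(j.+1 <= i < l.+1) (lam + i%:R)) /
    ((l - j)`!%:R * j`!%:R) * t ^+ j.

Section ka_measure.
Context {R : realType} {N : nat}.
Local Notation V := 'rV[R]_N.
Variables (Rt : {fset V}) (k : V -> R) (a : R).

Definition ka_weight (x : V) : R :=
  enorm x `^ (a - 2) * \prod_(al <- Rt) `|dotp al x| `^ k al.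

Lemma ka_weight_ge0 x : 0 <= ka_weight x.
Proof. by rewrite mulr_ge0 ?powR_ge0// prodr_ge0// => al _; exact: powR_ge0. Qed.

Lemma measurable_dotp d (T : measurableType d) (f g : T -> V) :
  measurable_fun setT f -> measurable_fun setT g ->
  measurable_fun setT (fun x => dotp (f x) (g x)).
Proof.
move=> mf mg; apply: measurable_sum => i; apply: measurable_funM.
  exact: (measurableT_comp (measurable_coor i)).
exact: (measurableT_comp (measurable_coor i)).
Qed.

Lemma measurable_ka_weight : measurable_fun setT ka_weight.
Proof.
apply: measurable_funM.
  apply: (measurableT_comp (measurable_powR (a - 2))).
  apply: (measurableT_comp (continuous_measurable_fun (@sqrt_continuous R))).
  by apply: measurable_dotp; exact: measurable_id.
apply: measurable_prod => al _.
apply: (measurableT_comp (measurable_powR (k al))).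
apply: (measurableT_comp (@normr_measurable R setT)).
by apply: measurable_dotp => //; exact: measurable_cst.
Qed.

Definition ka_measure (A : set V) : \bar R :=
  (\int[rV_lebesgue N]_(x in A) (ka_weight x)%:E)%E.

Let ka_measure0 : ka_measure set0 = 0%E.
Proof. exact: integral_set0. Qed.

Let ka_measure_ge0 A : (0 <= ka_measure A)%E.
Proof. by apply: integral_ge0 => x _; rewrite lee_fin ka_weight_ge0. Qed.

Let ka_measure_sigma_additive : semi_sigma_additive ka_measure.
Proof.
apply: semi_sigma_additive_nng_induced => [|x].
  by apply/measurable_EFinP; exact: measurable_ka_weight.
by rewrite lee_fin ka_weight_ge0.
Qed.

HB.instance Definition _ := isMeasure.Build _ _ _ ka_measure
  ka_measure0 ka_measure_ge0 ka_measure_sigma_additive.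

End ka_measure.

Section ka_fourier.
Context {R : realType} {N : nat}.
Local Notation V := 'rV[R]_N.
Variables (Rt Rp : {fset V}) (k : V -> R) (a : R).
Local Notation mu := (ka_measure Rt k a).

Definition ka_lambda (m : nat) : R :=
  (2 * m%:R + 2 * ksum Rt k + N%:R - 2) / a.

Definition ka_Phi (l m : nat) (p : V -> R) (x : V) : R :=
  p x * laguerre l (ka_lambda m) (2 / a * enorm x `^ a) *
  expR (- (enorm x `^ a / a)).

(* U = exp (i t Delta_{k,a}), for the self-adjoint realisation of Delta_{k,a}
   diagonalised by the functions ka_Phi: an eigenfunction with eigenvalue lam
   is multiplied by exp (i t lam).  Real polynomials p suffice, since U is
   C-linear and the real and imaginary parts of a Dunkl harmonic polynomial are
   Dunkl harmonic. *)
Definition is_exp_i_Delta (t : R) (U : (V -> R[i]) -> (V -> R[i])) : Prop :=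
  unitary_on_L2 mu U /\
  forall (l m : nat) (p : V -> R) (lam : R),
    is_homog_poly m p -> is_dunkl_harmonic Rt Rp k p ->
    (forall x, regular Rt x ->
      Delta_ka Rp k a (ka_Phi l m p) x = lam * ka_Phi l m p x) ->
    cae_eq mu (U (fun x => Complex (ka_Phi l m p x) 0))
              (fun x => expi (t * lam) * Complex (ka_Phi l m p x) 0).

(* A single operator F on all the L^p, 1 <= p <= 2: on L^2 the unitary operator
   given by the exponentials, on L^1 the integral operator with kernel c * B,
   and for 1 < p <= 2 the bounded linear extension to L^p -> L^p' given by the
   Hausdorff-Young inequality. *)
Definition is_ka_fourier (c : R[i]) (B : V -> V -> R[i])
    (F : (V -> R[i]) -> (V -> R[i])) : Prop :=
  [/\ exists2 U, is_exp_i_Delta (pi / (2 * a)) U &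
        forall f, in_Lp mu 2 f ->
          cae_eq mu (F f) (fun x =>
            expi (pi / 2 * ((2 * ksum Rt k + N%:R + a - 2) / a)) * U f x),
      forall f, in_Lp mu 1 f ->
        cae_eq mu (F f) (fun xi => c * cintegral mu (fun x => B xi x * f x)),
      forall p, 1 <= p <= 2 -> linear_on_Lp mu p F
    & forall p, 1 < p <= 2 -> exists C : R, forall f, in_Lp mu p f ->
        in_Lp mu (p / (p - 1)) (F f) /\
        (cLnorm mu (p / (p - 1)) (F f) <= C%:E * cLnorm mu p f)%E].

Definition is_bounded_kernel (B : V -> V -> R[i]) : Prop :=
  [/\ cmeasurable (fun z : V * V => B z.1 z.2),
      forall xi x, B xi x = B x xi
    & exists M : R, forall xi x, Normc.normc (B xi x) <= M].

Definition weak_const (psi : V -> R) : \bar R :=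
  ereal_sup [set (t%:E * mu [set xi | (t <= psi xi)%R])%E
    | t in [set t : R | 0 < t]].

End ka_fourier.

(* Main.v *)
(** Marcinkiewicz interpolation by hand.  With respect to [psi^2 dmu] the operator
    [f |-> F f / psi] is isometric on [L^2] (Plancherel) and of weak type (1,1):
    if [|F f| <= K ||f||_1], then [|F f| / psi > s] forces [psi < K ||f||_1 / s],
    and the growth hypothesis on [psi] gives [\int_(psi <= w) psi^2 dmu <= 8 M_psi w].
    At each height [s = 2^i delta] one splits [f] at [|f| = s] into an [L^1] part
    and an [L^2] part; summing the level-set estimates over [i] leaves geometric
    sums in [s^(p-1)] and [s^(p-2)], which converge exactly for [1 < p < 2].  Only
    finite ranges of [i] are used, with bounds uniform in [delta] and in the range;
    monotone convergence does the rest.  Rescaling [psi] by [M_psi] produces the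
    power of [M_psi].  The case [p = 2] is Plancherel, and [M_psi = 0] forces
    [mu = 0]. *)
Require Import Defs.
From mathcomp Require Import all_boot all_order all_algebra.
From mathcomp Require Import finmap.
From mathcomp Require Import complex.
From mathcomp Require Import ring lra.
From mathcomp Require Import all_classical all_reals all_analysis.
From mathcomp Require Import measurable_realfun.
Set Implicit Arguments.
Unset Strict Implicit.
Unset Printing Implicit Defensive.
Import Order.TTheory GRing.Theory Num.Theory.
Import numFieldNormedType.Exports.
Local Open Scope classical_set_scope.
Local Open Scope ring_scope.

(** * Geometric sums over dyadic heights *)

Section dyadic_sums.
Context {R : realType}.
Implicit Types (p q r e u w delta h : R) (m : nat).

(** The terms grow, so the last one below [w] dominates. If the top term is below [w], the full sum
    up to it is at most [q / (q - 1)] times that term; otherwise the top term vanishes and induction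
    applies. Hence the bound is uniform in [m]. *)
Lemma sum_geometric_lt q e w m : 1 < q -> 0 <= e -> 0 <= w ->
  \sum_(i < m) q ^+ i * e * (q ^+ i * e < w)%R%:R <= q / (q - 1) * w.
Proof.
move=> q1 e0 w0.
have q10 : 0 < q - 1 by rewrite subr_gt0.
have q0 : 0 < q by rewrite (lt_trans _ q1).
have full n : \sum_(i < n) q ^+ i * e * (q ^+ i * e < w)%R%:R
              <= (q ^+ n * e) / (q - 1).
  elim: n => [|n ih].
    by rewrite big_ord0 divr_ge0 ?mulr_ge0 ?exprn_ge0// ltW.
  rewrite big_ord_recr/=; apply: (le_trans (lerD ih (_ : _ <= q ^+ n * e))).
    by rewrite ler_piMr ?mulr_ge0 ?exprn_ge0 ?lern1 ?leq_b1// ltW.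
  by rewrite exprS le_eqVlt; apply/orP; left; apply/eqP; field; rewrite gt_eqF.
elim: m => [|m ih].
  by rewrite big_ord0 mulr_ge0// divr_ge0// ltW.
have [qw|qw] := ltP (q ^+ m * e) w; last first.
  by rewrite big_ord_recr/= ltNge qw/= mulr0 addr0.
rewrite (le_trans (full _))// exprS -!mulrA ler_pM2l// mulrA mulrC.
by rewrite ler_pM2l ?invr_gt0// ltW.
Qed.

(** Mirror image for decreasing terms: the first one that is at most [w] dominates. The induction
    peels off the first term and restarts from [r * e], so [e] has to vary. *)
Lemma sum_geometric_ge r e w m : 0 < r -> r < 1 -> 0 <= e -> 0 <= w ->
  \sum_(i < m) r ^+ i * e * (r ^+ i * e <= w)%R%:R <= w / (1 - r).
Proof.
move=> r0 r1 + w0; have r10 : 0 < 1 - r by rewrite subr_gt0.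
have full n e' : 0 <= e' ->
    \sum_(i < n) r ^+ i * e' * (r ^+ i * e' <= w)%R%:R <= e' / (1 - r).
  elim: n e' => [e' e0|n ih e' e0]; first by rewrite big_ord0 divr_ge0// ltW.
  rewrite big_ord_recl/= expr0 mul1r.
  under eq_bigr do rewrite /bump/= exprSr -(mulrA (r ^+ _)).
  have re0 : 0 <= r * e' by rewrite mulr_ge0// ltW.
  apply: (le_trans (lerD (_ : _ <= e') (ih _ re0))).
    by rewrite ler_piMr ?lern1 ?leq_b1.
  by rewrite le_eqVlt; apply/orP; left; apply/eqP; field; rewrite gt_eqF.
elim: m e => [e e0|m ih e e0]; first by rewrite big_ord0 divr_ge0// ltW.
have [ew|ew] := leP e w.
  by rewrite (le_trans (full _ _ e0))// ler_pM2r ?invr_gt0.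
rewrite big_ord_recl/= expr0 mul1r (leNgt e) ew/= mulr0 add0r.
under eq_bigr do rewrite /bump/= exprSr -(mulrA (r ^+ _)).
by apply: ih; rewrite mulr_ge0// ltW.
Qed.

(** Some [i < m] satisfies [2 ^+ i * delta < h <= 2 ^+ i.+1 * delta], and its term alone already
    dominates. This is the pointwise form of a discrete layer-cake formula. *)
Lemma powR_dyadic_le p delta h m : 0 <= p -> 0 < delta ->
  delta < h -> h <= 2 ^+ m * delta ->
  h `^ p <= \sum_(i < m) (2 * (2 ^+ i * delta)) `^ p * (2 ^+ i * delta < h)%R%:R.
Proof.
move=> p0 d0 dh; elim: m => [|m ih hm].
  by rewrite expr0 mul1r => /(lt_le_trans dh); rewrite ltxx.
have s0 n : 0 <= 2 ^+ n * delta by rewrite mulr_ge0// ?exprn_ge0// ltW.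
rewrite big_ord_recr/=; have [hm'|hm'] := leP h (2 ^+ m * delta).
  by rewrite mulr0 addr0 ih.
rewrite mulr1 (@le_trans _ _ ((2 * (2 ^+ m * delta)) `^ p))//.
  apply: ge0_ler_powR; rewrite ?nnegrE//.
  - by rewrite (le_trans _ (ltW dh))// ltW.
  - by rewrite mulr_ge0.
  - by rewrite mulrA -exprS.
by rewrite lerDr sumr_ge0// => i _; rewrite mulr_ge0 ?powR_ge0.
Qed.

Lemma powR_dyadic p delta i : 0 < delta ->
  (2 ^+ i * delta) `^ p = (2 `^ p) ^+ i * delta `^ p.
Proof.
move=> d0; rewrite powRM ?exprn_ge0 ?(ltW d0)//; congr (_ * _).
by rewrite -powR_mulrn// powRAC powR_mulrn// powR_ge0.
Qed.

Lemma powR2_gt1 p : 0 < p -> 1 < 2 `^ p :> R.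
Proof.
move=> p0; rewrite -[X in X < _](powRr0 2) /powR; case: ifPn => [/eqP|_]; first by lra.
by rewrite ltr_expR ltr_pM2r// ln_gt0//; lra.
Qed.

Lemma powR2_lt1 p : p < 0 -> 2 `^ p < 1 :> R.
Proof.
move=> p0; rewrite -[X in _ < X](powRr0 2) /powR; case: ifPn => [/eqP|_]; first by lra.
by rewrite ltr_expR ltr_pM2r// ln_gt0//; lra.
Qed.

(** Serves the L^1 parts of the cuts. The heights' powers form a geometric sequence of ratio [2]^ (p
    - 1)[, which exceeds 1 because]p > 1[; one factor]u[is set aside from]u [^ p]. *)
Lemma sum_dyadic_lt p delta u m : 1 < p -> 0 < delta -> 0 <= u ->
  \sum_(i < m) (2 ^+ i * delta) `^ (p - 1) * (2 ^+ i * delta < u)%R%:R * u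
  <= 2 `^ (p - 1) / (2 `^ (p - 1) - 1) * u `^ p.
Proof.
move=> p1 d0 u0.
have q1 : 1 < 2 `^ (p - 1) :> R by rewrite powR2_gt1// subr_gt0.
rewrite -mulr_suml -[u `^ p](@mulr_powRB1 _ u p)//; last by lra.
rewrite [u * _]mulrC mulrA ler_wpM2r//.
set D := delta `^ (p - 1).
have D0 : 0 <= D by exact: powR_ge0.
apply: (le_trans _ (@sum_geometric_lt _ D (u `^ (p - 1)) m q1 D0 (powR_ge0 _ _))).
apply: ler_sum => i _; rewrite powR_dyadic// -/D.
have [su|_] := ltP (2 ^+ i * delta) u; last first.
  by rewrite mulr0 mulr_ge0// mulr_ge0// exprn_ge0// powR_ge0.
rewrite -powR_dyadic// gt0_ltr_powR ?nnegrE ?mulr_ge0 ?exprn_ge0 ?(ltW d0)//.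
by rewrite subr_gt0.
Qed.

Lemma sum_dyadic_ge p delta u m : p < 2 -> 0 < delta -> 0 <= u ->
  \sum_(i < m) (2 ^+ i * delta) `^ (p - 2) * (u <= 2 ^+ i * delta)%R%:R * u ^+ 2
  <= u `^ p / (1 - 2 `^ (p - 2)).
Proof.
move=> p2 d0; rewrite le_eqVlt => /predU1P[<-|u0].
  rewrite big1 => [|i _]; last by rewrite expr0n mulr0.
  rewrite divr_ge0 ?powR_ge0// subr_ge0 -[X in _ <= X](powRr0 2).
  by rewrite ler_powR//; lra.
have r1 : 2 `^ (p - 2) < 1 :> R by rewrite powR2_lt1// subr_lt0.
have -> : u `^ p = u `^ (p - 2) * u ^+ 2.
  by rewrite -powR_mulrn ?ltW// -powRD ?subrK// (gt_eqF u0) implybT.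
rewrite -mulr_suml mulrAC ler_wpM2r ?sqr_ge0//.
set D := delta `^ (p - 2).
have D0 : 0 <= D by exact: powR_ge0.
apply: (le_trans _ (@sum_geometric_ge _ D (u `^ (p - 2)) m _ r1 D0 (powR_ge0 _ _))).
  apply: ler_sum => i _; rewrite powR_dyadic// -/D.
  have [us|_] := leP u (2 ^+ i * delta); last first.
    by rewrite mulr0 mulr_ge0// mulr_ge0// exprn_ge0// powR_ge0.
  rewrite -powR_dyadic// (_ : (_ <= u `^ _) = true)//.
  have s0 := lt_le_trans u0 us.
  rewrite -[p - 2]opprB !powRN lef_pV2 ?posrE ?powR_gt0//.
  by apply: ge0_ler_powR => //; rewrite ?nnegrE ?subr_ge0 ltW.
by rewrite powR_gt0.
Qed.

End dyadic_sums.

(** * Measurability of comparisons, powers and inverses *)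

Section measurability.
Context d (T : measurableType d) {R : realType}.
Implicit Types f g : T -> R.

Lemma measurable_ltr_indic f g : measurable_fun setT f -> measurable_fun setT g ->
  measurable_fun setT (fun x => (f x < g x)%R%:R : R).
Proof.
move=> mf mg; rewrite (_ : (fun x => _) = (fun x => if f x < g x then 1 else 0)).
  by apply: measurable_fun_ifT => //; exact: measurable_fun_ltr.
by apply/funext => x; case: ifP.
Qed.

Lemma measurable_ler_indic f g : measurable_fun setT f -> measurable_fun setT g ->
  measurable_fun setT (fun x => (f x <= g x)%R%:R : R).
Proof.
move=> mf mg; rewrite (_ : (fun x => _) = (fun x => if f x <= g x then 1 else 0)).
  by apply: measurable_fun_ifT => //; exact: measurable_fun_ler.
by apply/funext => x; case: ifP.
Qed.

Lemma measurable_powR_fun f p : measurable_fun setT f ->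
  measurable_fun setT (fun x => f x `^ p).
Proof. by move=> mf; exact: (measurableT_comp (measurable_powR p) mf). Qed.

Lemma measurable_inv_gt0 f : measurable_fun setT f -> (forall x, 0 < f x) ->
  measurable_fun setT (fun x => (f x)^-1).
Proof.
move=> mf f0; rewrite (_ : (fun x => _) = (fun x => f x `^ (-1))).
  exact: measurable_powR_fun.
by apply/funext => x; rewrite powR_inv1// ltW.
Qed.

Lemma measurable_superlevel f (t : R) : measurable_fun setT f ->
  measurable [set x | t <= f x].
Proof.
move=> mf; rewrite -[X in measurable X]setTI.
exact: (@measurable_fun_ler _ T R setT (cst t) f _ _ measurableT [set true]).
Qed.

End measurability.

(** * Integrals of nonnegative functions and the dyadic layer-cake bound *)

Section real_integrals.
Context d (T : measurableType d) {R : realType}.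
Variable mu : {measure set T -> \bar R}.
Implicit Types f g h v : T -> R.
Local Notation mfun := (measurable_fun [set: T]).

Lemma le_integral_EFin_ae f g : mfun f -> mfun g -> (forall x, 0 <= f x) ->
  (forall x, 0 <= g x) -> {ae mu, forall x, f x <= g x} ->
  (\int[mu]_x (f x)%:E <= \int[mu]_x (g x)%:E)%E.
Proof.
move=> mf mg f0 g0 fg; apply: ae_ge0_le_integral => //.
- by move=> x _; rewrite lee_fin.
- exact/measurable_EFinP.
- by move=> x _; rewrite lee_fin.
- exact/measurable_EFinP.
- by apply: filterS fg => x fgx _; rewrite lee_fin.
Qed.

Lemma le_integral_EFin f g : mfun f -> mfun g -> (forall x, 0 <= f x) ->
  (forall x, f x <= g x) ->
  (\int[mu]_x (f x)%:E <= \int[mu]_x (g x)%:E)%E.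
Proof.
move=> mf mg f0 fg; apply: le_integral_EFin_ae => //.
  by move=> x; rewrite (le_trans (f0 x)).
exact: aeW.
Qed.

Lemma integral_EFinZ f (c : R) : mfun f -> (forall x, 0 <= f x) -> 0 <= c ->
  (\int[mu]_x (c * f x)%:E = c%:E * \int[mu]_x (f x)%:E)%E.
Proof.
move=> mf f0 c0; under eq_integral do rewrite EFinM.
rewrite ge0_integralZl_EFin// => [x _|]; first by rewrite lee_fin.
exact/measurable_EFinP.
Qed.

Lemma integral_EFinD f g : mfun f -> mfun g -> (forall x, 0 <= f x) ->
  (forall x, 0 <= g x) ->
  (\int[mu]_x (f x + g x)%:E = \int[mu]_x (f x)%:E + \int[mu]_x (g x)%:E)%E.
Proof.
move=> mf mg f0 g0; under eq_integral do rewrite EFinD.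
rewrite ge0_integralD// => [x _||x _|]; rewrite ?lee_fin//; exact/measurable_EFinP.
Qed.

Lemma integral_EFin_sum m (f : 'I_m -> T -> R) : (forall i, mfun (f i)) ->
  (forall i x, 0 <= f i x) ->
  (\int[mu]_x (\sum_(i < m) f i x)%:E = \sum_(i < m) \int[mu]_x (f i x)%:E)%E.
Proof.
move=> mf f0; under eq_integral do rewrite -sumEFin.
rewrite ge0_integral_sum// => [i|i x _]; rewrite ?lee_fin//; exact/measurable_EFinP.
Qed.

(** Monotone convergence, in the form that lets bounds over finite ranges of heights pass to the
    whole space. *)
Lemma integral_le_exhaustion f (A : (set T)^nat) (C : \bar R) : mfun f ->
  (forall x, 0 <= f x) -> (forall n, measurable (A n)) -> nondecreasing_seq A ->
  (forall x, f x != 0 -> exists n, A n x) ->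
  (forall n, \int[mu]_(x in A n) (f x)%:E <= C)%E ->
  (\int[mu]_x (f x)%:E <= C)%E.
Proof.
move=> mf f0 mA ndA fA fC.
have mf' : measurable_fun setT (EFin \o f) by exact/measurable_EFinP.
have -> : (\int[mu]_x (f x)%:E = \int[mu]_(x in \bigcup_n A n) (f x)%:E)%E.
  rewrite [RHS]integral_mkcond; apply: eq_integral => x _; rewrite patchE.
  case: ifPn => // /negP; rewrite inE => nA; congr EFin.
  by apply: contra_notP nA => /eqP /fA[n Anx]; exists n.
have cv := @ge0_nondecreasing_set_cvg_integral _ T R A (EFin \o f) mu ndA mA
  (fun i => measurable_funTS mf') (fun i x _ => f0 x).
rewrite -(cvg_lim _ cv)//; apply: lime_le; first by apply/cvg_ex; eexists; exact: cv.
exact: nearW.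
Qed.

Lemma integral_powR_le_dyadic (p : R) (C : \bar R) h v : 0 < p ->
  mfun h -> mfun v -> (forall x, 0 <= h x) -> (forall x, 0 <= v x) ->
  (forall (m : nat) (delta : R), (0 < delta)%R ->
    \sum_(i < m) ((2 * (2 ^+ i * delta)) `^ p)%:E *
      \int[mu]_x (v x * (2 ^+ i * delta < h x)%R%:R)%:E <= C)%E ->
  (\int[mu]_x (h x `^ p * v x)%:E <= C)%E.
Proof.
move=> p0 mh mv h0 v0 hC.
have mhv : mfun (fun x => h x `^ p * v x).
  by apply: measurable_funM => //; exact: measurable_powR_fun.
have ds n : 0 < 2 ^- n :> R by rewrite invr_gt0 exprn_gt0.
(* On [A n] the values of [h] are covered by the [2n] dyadic steps that start at [delta = 2 ^- n]
   and end at [2 ^+ n]. *)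
pose A n := [set x | 2 ^- n < h x] `&` [set x | h x <= 2 ^+ n].
have mA n : measurable (A n).
  apply: measurableI.
  + rewrite -[X in measurable X]setTI.
    exact: (@measurable_fun_ltr _ T R setT (cst (2 ^- n)) h _ _ measurableT [set true]).
  + rewrite -[X in measurable X]setTI.
    exact: (@measurable_fun_ler _ T R setT h (cst (2 ^+ n)) _ _ measurableT [set true]).
apply: (@integral_le_exhaustion _ A) => //.
- by move=> x; rewrite mulr_ge0// powR_ge0.
- apply/nondecreasing_seqP => n; rewrite subsetEset => x [/= nh hn]; split => /=.
    by rewrite (le_lt_trans _ nh)// lef_pV2 ?posrE ?exprn_gt0// ler_eXn2l// ltr1n.
  by rewrite (le_trans hn)// ler_eXn2l// ltr1n.
- move=> x hv; have hx : 0 < h x.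
    rewrite lt_neqAle h0 andbT eq_sym; apply: contraNneq hv => ->.
    by rewrite powR0 ?mul0r// gt_eqF.
  (* A single index above [(h x)^-1 + h x] serves both bounds that define [A n]. *)
  have y0 : 0 <= (h x)^-1 + h x by rewrite addr_ge0// invr_ge0.
  have yn : (h x)^-1 + h x < 2 ^+ Num.bound ((h x)^-1 + h x).
    by rewrite (lt_trans (archi_boundP y0))// -natrX ltr_nat ltn_expl.
  exists (Num.bound ((h x)^-1 + h x)); split => /=.
    rewrite invf_plt ?posrE ?exprn_gt0//.
    by rewrite (le_lt_trans _ yn)// lerDl.
  by rewrite ltW// (le_lt_trans _ yn)// lerDr invr_ge0.
move=> n; apply: le_trans (hC (n + n)%N (2 ^- n) (ds n)).
have mi i : mfun (fun x => v x * (2 ^+ i * 2 ^- n < h x)%R%:R).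
  by apply: measurable_funM => //; exact: measurable_ltr_indic.
rewrite integral_mkcond.
under [leRHS]eq_bigr => i _.
  rewrite -integral_EFinZ ?powR_ge0//; last by move=> x; rewrite mulr_ge0.
  over.
rewrite -(@integral_EFin_sum _ (fun i x => _ * _)) => [|i|i x]; last 2 first.
- by apply: measurable_funM => //; exact: mi.
- by rewrite mulr_ge0 ?powR_ge0// mulr_ge0.
have S0 x : 0 <= \sum_(i < n + n) (2 * (2 ^+ i * 2 ^- n)) `^ p *
    (v x * (2 ^+ i * 2 ^- n < h x)%R%:R).
  by apply: sumr_ge0 => i _; rewrite mulr_ge0 ?powR_ge0// mulr_ge0.
have -> : (fun x => (h x `^ p * v x)%:E) \_ (A n) =
    (fun x => (h x `^ p * v x * (x \in A n)%:R)%:E).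
  by apply/funext => x; rewrite patchE; case: ifP; rewrite ?mulr1 ?mulr0.
apply: le_integral_EFin.
- apply: measurable_funM => //.
  have -> : (fun x => (x \in A n)%:R) = \1_(A n) :> (T -> R) by [].
  exact: measurable_indic.
- by apply: measurable_sum => i; apply: measurable_funM => //; exact: mi.
- by move=> x; rewrite !mulr_ge0// powR_ge0.
move=> x; have [Ax|_] := boolP (x \in A n); last by rewrite mulr0.
rewrite mulr1; move: Ax; rewrite inE => -[/= nh hn].
under eq_bigr do rewrite mulrCA mulrC.
rewrite -mulr_suml ler_wpM2r// powR_dyadic_le ?(ltW p0)//.
by rewrite exprD -mulrA mulfV ?mulr1// expf_neq0.
Qed.

End real_integrals.

(** * Weak-type level-set estimates and real interpolation *)

Section paley.
Context d (T : measurableType d) {R : realType}.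
Variable mu : {measure set T -> \bar R}.
Implicit Types f g h v u psi : T -> R.
Local Notation mfun := (measurable_fun [set: T]).

(** The set where [s < psi <= w] has measure at most [1 / s], and is empty once [s >= w]. With the
    weight [(2 s) ^ 2] each height costs at most [4 s], and the dyadic [s < w] sum to at most [2 w],
    whence 8. *)
Lemma integral_sublevel_le psi w : mfun psi -> (forall x, 0 < psi x) ->
  (forall t : R, 0 < t -> (t%:E * mu [set x | (t <= psi x)%R] <= 1)%E) -> 0 <= w ->
  (\int[mu]_x (psi x ^+ 2 * (psi x <= w)%R%:R)%:E <= (8 * w)%:E)%E.
Proof.
move=> mpsi psi0 wk w0.
under eq_integral do rewrite -powR_mulrn ?(ltW (psi0 _))//.
have mw : mfun (fun x => (psi x <= w)%R%:R : R) by exact: measurable_ler_indic.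
apply: integral_powR_le_dyadic => //; first by move=> x; exact: ltW.
move=> m delta d0.
have s0 i : 0 < 2 ^+ i * delta by rewrite mulr_gt0// exprn_gt0.
have level i : (\int[mu]_x ((psi x <= w)%R%:R * (2 ^+ i * delta < psi x)%R%:R)%:E
    <= ((2 ^+ i * delta)^-1 * (2 ^+ i * delta < w)%R%:R)%:E)%E.
  have [sw|ws] := ltP (2 ^+ i * delta) w; last first.
    rewrite mulr0 integral0_eq// => x _.
    by have [pw|] := leP (psi x) w; rewrite ?mul0r// ltNge (le_trans pw ws) mulr0.
  rewrite mulr1.
  have mA : measurable [set x | 2 ^+ i * delta <= psi x].
    exact: measurable_superlevel.
  apply: (@le_trans _ _ (\int[mu]_x (\1_[set x | 2 ^+ i * delta <= psi x] x)%:E)%E).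
    apply: le_integral_EFin => //.
    - by apply: measurable_funM => //; exact: measurable_ltr_indic.
    - move=> x; rewrite indicE.
      have [sp|_] := ltP (2 ^+ i * delta) (psi x); last by rewrite mulr0.
      by rewrite mem_set ?mulr1 ?lern1 ?leq_b1//= ltW.
  rewrite integral_indic// setIT.
  by rewrite -(@lee_pmul2l _ (2 ^+ i * delta)%:E) ?lte_fin// -EFinM mulfV ?wk ?gt_eqF.
apply: (@le_trans _ _ (\sum_(i < m)
    (4 * (2 ^+ i * delta * (2 ^+ i * delta < w)%R%:R))%:E)%E).
  apply: lee_sum => i _.
  apply: le_trans (lee_wpmul2l _ (level i)) _; first by rewrite lee_fin powR_ge0.
  rewrite -EFinM lee_fin powR_mulrn; last by rewrite mulr_ge0 ?ltW.
  rewrite le_eqVlt; apply/orP; left; apply/eqP; set b := (_ < w)%R%:R.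
  by have := s0 i; move: (2 ^+ i * delta) => s s0'; field; rewrite gt_eqF.
rewrite sumEFin lee_fin -mulr_sumr.
have -> : 8 * w = 4 * (2 / (2 - 1) * w) :> R.
  by rewrite [2 - 1](_ : _ = 1); [rewrite divr1; ring|ring].
by rewrite ler_pM2l// sum_geometric_lt// ?ltr1n// ltW.
Qed.

(** Split at [psi = 2 b / s]. Below it, the sublevel estimate gives [8 * (2 b / s)]. Above it
    [b < s psi / 2], so [s psi < g <= b + g2] forces [s psi <= 2 g2], and [psi ^+ 2] is at most
    [4 g2 ^+ 2 / s ^+ 2] pointwise. *)
Lemma integral_level_le psi g g2 (s b : R) : mfun psi -> (forall x, 0 < psi x) ->
  (forall t : R, 0 < t -> (t%:E * mu [set x | (t <= psi x)%R] <= 1)%E) ->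
  0 < s -> 0 <= b -> mfun g -> mfun g2 ->
  (forall x, 0 <= g2 x) ->
  {ae mu, forall x, g x <= b + g2 x} ->
  (\int[mu]_x (psi x ^+ 2 * (s < g x / psi x)%R%:R)%:E <=
   (16 * b / s)%:E + (4 / s ^+ 2)%:E * \int[mu]_x (g2 x ^+ 2)%:E)%E.
Proof.
move=> mpsi psi0 wk s0 b0 mg mg2 g20 gle.
have w0 : 0 <= 2 * b / s by rewrite divr_ge0 ?mulr_ge0// ltW.
have mi : mfun (fun x => psi x ^+ 2 * (psi x <= 2 * b / s)%R%:R).
  by apply: measurable_funM; [exact: measurable_funX|exact: measurable_ler_indic].
have mV : mfun (fun x => (psi x)^-1) by exact: measurable_inv_gt0.
have -> : (16 * b / s)%:E = (8 * (2 * b / s))%:E :> \bar R by congr EFin; ring.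
apply: le_trans (leeD2r _ (integral_sublevel_le mpsi psi0 wk w0)).
rewrite -integral_EFinZ//; last 3 first.
- exact: measurable_funX.
- by move=> x; exact: sqr_ge0.
- by rewrite divr_ge0// sqr_ge0.
have m2 : mfun (fun x => 4 / s ^+ 2 * g2 x ^+ 2).
  by apply: measurable_funM => //; exact: measurable_funX.
have n2 x : 0 <= 4 / s ^+ 2 * g2 x ^+ 2 by rewrite mulr_ge0 ?sqr_ge0// divr_ge0 ?sqr_ge0.
rewrite -integral_EFinD//; last by move=> x; rewrite mulr_ge0 ?sqr_ge0.
apply: le_integral_EFin_ae.
- apply: measurable_funM; first exact: measurable_funX.
  by apply: measurable_ltr_indic => //; exact: measurable_funM.
- exact: measurable_funD.
- by move=> x; rewrite mulr_ge0 ?sqr_ge0.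
- by move=> x; rewrite addr_ge0// mulr_ge0 ?sqr_ge0.
apply: filterS gle => x gx.
have [sg|_] := ltP s (g x / psi x); last first.
  by rewrite mulr0 addr_ge0// mulr_ge0 ?sqr_ge0.
rewrite mulr1; have [_|pw] := leP (psi x) (2 * b / s); first by rewrite mulr1 lerDl.
rewrite mulr0 add0r.
have {}sg : s * psi x < b + g2 x by rewrite (lt_le_trans _ gx)// -ltr_pdivlMr.
have bs : 2 * b < s * psi x by rewrite [s * _]mulrC -ltr_pdivrMr.
have sg2 : s * psi x <= 2 * g2 x by lra.
rewrite mulrAC ler_pdivlMr ?exprn_gt0// -exprMn [_ * s]mulrC.
have -> : 4 * g2 x ^+ 2 = (2 * g2 x) ^+ 2 by ring.
by rewrite ler_sqr ?nnegrE// ?mulr_ge0// ltW.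
Qed.

Definition paley_cst (p K : R) : R :=
  2 `^ p * (16 * K * (2 `^ (p - 1) / (2 `^ (p - 1) - 1)) + 4 / (1 - 2 `^ (p - 2))).

Lemma paley_cst_gt0 p K : 1 < p -> p < 2 -> 0 <= K -> 0 < paley_cst p K.
Proof.
move=> p1 p2 K0; have q1 : 1 < 2 `^ (p - 1) :> R by rewrite powR2_gt1// subr_gt0.
have r1 : 2 `^ (p - 2) < 1 :> R by rewrite powR2_lt1// subr_lt0.
rewrite mulr_gt0 ?powR_gt0// ltr_wpDl//; last by rewrite divr_gt0// subr_gt0.
by rewrite !mulr_ge0 ?powR_ge0// invr_ge0 subr_ge0 ltW.
Qed.

(** Here [u] stands for [|f|] and [g] for [|F f|]. The operator enters only through the splitting
    available at each height [s], with a bounded part [b] and a square-integrable type part [g2]. *)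
Lemma paley_interpolation psi u g (p K : R) : 1 < p -> p < 2 -> 0 <= K ->
  mfun psi -> (forall x, 0 < psi x) ->
  (forall t : R, 0 < t -> (t%:E * mu [set x | (t <= psi x)%R] <= 1)%E) ->
  mfun u -> (forall x, 0 <= u x) -> mfun g -> (forall x, 0 <= g x) ->
  (forall s, 0 < s -> exists (b : R) g2,
     [/\ 0 <= b, mfun g2 /\ (forall x, 0 <= g2 x),
         {ae mu, forall x, g x <= b + g2 x},
         (b%:E <= K%:E * \int[mu]_x (u x * (s < u x)%R%:R)%:E)%E &
         (\int[mu]_x (g2 x ^+ 2)%:E <=
          \int[mu]_x (u x ^+ 2 * (u x <= s)%R%:R)%:E)%E]) ->
  (\int[mu]_x (g x `^ p * psi x `^ (2 - p))%:E <=
   (paley_cst p K)%:E * \int[mu]_x (u x `^ p)%:E)%E.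
Proof.
move=> p1 p2 K0 mpsi psi0 wk mu_ u0 mg g0 split_at.
have p0 : 0 < p by lra.
have mV : mfun (fun x => (psi x)^-1) by exact: measurable_inv_gt0.
(* Passes to the function [g / psi] and the measure [psi ^+ 2 dmu]. *)
have -> : (\int[mu]_x (g x `^ p * psi x `^ (2 - p))%:E =
           \int[mu]_x ((g x / psi x) `^ p * psi x ^+ 2)%:E)%E.
  apply: eq_integral => x _; congr EFin.
  rewrite powRM// ?invr_ge0 ?(ltW (psi0 x))// -mulrA; congr (_ * _).
  rewrite -powR_inv1 ?(ltW (psi0 x))// -powRrM mulN1r -powR_mulrn ?(ltW (psi0 x))//.
  by rewrite -powRD 1?addrC// (gt_eqF (psi0 x)) implybT.
apply: integral_powR_le_dyadic => //.
- exact: measurable_funM.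
- exact: measurable_funX.
- by move=> x; rewrite divr_ge0// ltW.
- by move=> x; exact: sqr_ge0.
move=> m delta d0.
have s0 i : 0 < 2 ^+ i * delta by rewrite mulr_gt0// exprn_gt0.
(* With [s = 2 ^+ i * delta], [c1] is [(2 s)]^ p * 16 K / s[and]c2[is](2 s) [^ p * 4 / s ^+ 2]: the
   level-set weight times the coefficients of [integral_level_le]. *)
pose c1 i := 2 `^ p * (16 * K) * (2 ^+ i * delta) `^ (p - 1).
pose c2 i := 2 `^ p * 4 * (2 ^+ i * delta) `^ (p - 2).
have c10 i : 0 <= c1 i by rewrite !mulr_ge0 ?powR_ge0.
have c20 i : 0 <= c2 i by rewrite !mulr_ge0 ?powR_ge0.
have m1 i : mfun (fun x => u x * (2 ^+ i * delta < u x)%R%:R).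
  by apply: measurable_funM => //; exact: measurable_ltr_indic.
have m2 i : mfun (fun x => u x ^+ 2 * (u x <= 2 ^+ i * delta)%R%:R).
  by apply: measurable_funM; [exact: measurable_funX|exact: measurable_ler_indic].
have n1 i x : 0 <= u x * (2 ^+ i * delta < u x)%R%:R by rewrite mulr_ge0.
have n2 i x : 0 <= u x ^+ 2 * (u x <= 2 ^+ i * delta)%R%:R by rewrite mulr_ge0 ?sqr_ge0.
pose G i x := c1 i * (u x * (2 ^+ i * delta < u x)%R%:R) +
  c2 i * (u x ^+ 2 * (u x <= 2 ^+ i * delta)%R%:R).
have mG i : mfun (G i) by apply: measurable_funD; exact: measurable_funM.
have G0 i x : 0 <= G i x by rewrite addr_ge0// mulr_ge0.
apply: (@le_trans _ _ (\sum_(i < m) \int[mu]_x (G i x)%:E)%E).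
  apply: lee_sum => i _.
  have [b [g2 [b0 [mg2 g20] gle bK g2u]]] := split_at _ (s0 i).
  have := integral_level_le mpsi psi0 wk (s0 i) b0 mg mg2 g20 gle.
  move=> /(lee_wpmul2l (_ : (0 <= ((2 * (2 ^+ i * delta)) `^ p)%:E)%E)).
  rewrite lee_fin powR_ge0 => /(_ isT) /le_trans; apply.
  rewrite integral_EFinD//; last 4 first.
  - exact: measurable_funM.
  - exact: measurable_funM.
  - by move=> x; rewrite mulr_ge0.
  - by move=> x; rewrite mulr_ge0.
  rewrite !integral_EFinZ// ge0_muleDr ?mule_ge0 ?lee_fin//; last 3 first.
  - by rewrite !mulr_ge0// invr_ge0 ltW.
  - by rewrite divr_ge0// sqr_ge0.
  - by apply: integral_ge0 => x _; rewrite lee_fin sqr_ge0.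
  have sp : (2 * (2 ^+ i * delta)) `^ p = 2 `^ p * (2 ^+ i * delta) `^ p.
    by rewrite powRM// ltW.
  apply: leeD.
    have -> : ((16 * b / (2 ^+ i * delta))%:E = (16 / (2 ^+ i * delta))%:E * b%:E)%E.
      by rewrite -EFinM; congr EFin; rewrite mulrAC.
    rewrite muleA -EFinM.
    rewrite [X in (X <= _)%E]EFinM.    apply: le_trans (lee_wpmul2l _ bK) _.
      by rewrite lee_fin mulr_ge0 ?powR_ge0// divr_ge0// ltW.
    rewrite muleA -EFinM sp /c1 -(mulr_powRB1 (ltW (s0 i)) p0).
    rewrite le_eqVlt; apply/orP; left; apply/eqP; congr (_%:E * _)%E.
    by move: (2 ^+ i * delta) (s0 i) => s s_gt0; field; rewrite gt_eqF.
  rewrite muleA -EFinM.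
  apply: le_trans (lee_wpmul2l _ g2u) _.
    by rewrite lee_fin mulr_ge0 ?powR_ge0// divr_ge0// sqr_ge0.
  have -> : (2 * (2 ^+ i * delta)) `^ p =
      2 `^ p * ((2 ^+ i * delta) `^ (p - 2) * (2 ^+ i * delta) ^+ 2).
    rewrite sp; congr (_ * _); rewrite -(powR_mulrn 2 (ltW (s0 i))) -powRD ?subrK//.
    by rewrite (gt_eqF (s0 i)) implybT.
  rewrite /c2 le_eqVlt; apply/orP; left; apply/eqP; congr (_%:E * _)%E.
  by move: (2 ^+ i * delta) (s0 i) => s s_gt0; field; rewrite gt_eqF.
(* The finite sum goes back under the integral; what remains is pointwise in [x] and follows from
   the two dyadic sums. *)
rewrite -integral_EFin_sum// -integral_EFinZ//; last 3 first.
- exact: measurable_powR_fun.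
- by move=> x; exact: powR_ge0.
- exact/ltW/paley_cst_gt0.
apply: le_integral_EFin.
- exact: measurable_sum.
- by apply: measurable_funM => //; exact: measurable_powR_fun.
- by move=> x; exact: sumr_ge0.
move=> x; rewrite big_split/=.
have := sum_dyadic_lt m p1 d0 (u0 x); have := sum_dyadic_ge m p2 d0 (u0 x).
set S2 := \sum_(i < m) _; set S1 := \sum_(i < m) _ => h2 h1.
have -> : \sum_(i < m) c1 i * (u x * (2 ^+ i * delta < u x)%R%:R) =
    2 `^ p * (16 * K) * S1.
  by rewrite /S1 mulr_sumr; apply: eq_bigr => i _; rewrite /c1; ring.
have -> : \sum_(i < m) c2 i * (u x ^+ 2 * (u x <= 2 ^+ i * delta)%R%:R) =
    2 `^ p * 4 * S2.
  by rewrite /S2 mulr_sumr; apply: eq_bigr => i _; rewrite /c2; ring.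
apply: le_trans (lerD (ler_wpM2l _ h1) (ler_wpM2l _ h2)) _.
- by rewrite !mulr_ge0 ?powR_ge0.
- by rewrite mulr_ge0 ?powR_ge0.
- rewrite le_eqVlt; apply/orP; left; apply/eqP; rewrite /paley_cst.
  by move: (1 - _)^-1 (_ / (_ - 1)) => x1 x2; ring.
Qed.

End paley.


(** * The complex modulus, measurability and norms of complex functions *)

Section complex_modulus.
Context {R : realType}.
Implicit Types z : R[i].

Lemma normc_nneg z : 0 <= Normc.normc z.
Proof. by case: z => x y; exact: sqrtr_ge0. Qed.

Lemma normc_Re_le z : `|complex.Re z| <= Normc.normc z.
Proof. by case: z => x y /=; rewrite -sqrtr_sqr ler_wsqrtr// lerDl sqr_ge0. Qed.

Lemma normc_Im_le z : `|complex.Im z| <= Normc.normc z.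
Proof. by case: z => x y /=; rewrite -sqrtr_sqr ler_wsqrtr// lerDr sqr_ge0. Qed.

Lemma normc_le_ReDIm z : Normc.normc z <= `|complex.Re z| + `|complex.Im z|.
Proof.
case: z => x y /=; rewrite -[leRHS]ger0_norm ?addr_ge0// -sqrtr_sqr ler_wsqrtr//.
by rewrite sqrrD !real_normK ?num_real// lerD2r lerDl mulrn_wge0// mulr_ge0.
Qed.

Lemma normc_expi t : Normc.normc (expi t : R[i]) = 1.
Proof. by rewrite /expi/= cos2Dsin2 sqrtr1. Qed.

End complex_modulus.

Section complex_functions.
Context d (T : measurableType d) {R : realType}.
Variable mu : {measure set T -> \bar R}.
Implicit Types f g : T -> R[i].

Lemma measurable_normc f : cmeasurable f ->
  measurable_fun setT (fun x => Normc.normc (f x)).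
Proof.
move=> [mr mi]; rewrite (_ : (fun x => _) =
  (fun x => Num.sqrt (complex.Re (f x) ^+ 2 + complex.Im (f x) ^+ 2))).
  apply: (measurableT_comp (continuous_measurable_fun (@sqrt_continuous R))).
  by apply: measurable_funD; exact: measurable_funX.
by apply/funext => x; case: (f x).
Qed.

Lemma cmeasurableM f g : cmeasurable f -> cmeasurable g ->
  cmeasurable (fun x => f x * g x).
Proof.
move=> [fr fi] [gr gi]; split.
- rewrite (_ : (fun x => _) = (fun x => complex.Re (f x) * complex.Re (g x) -
    complex.Im (f x) * complex.Im (g x))).
    by apply: measurable_funB; exact: measurable_funM.
  by apply/funext => x; case: (f x); case: (g x).
- rewrite (_ : (fun x => _) = (fun x => complex.Re (f x) * complex.Im (g x) +
    complex.Im (f x) * complex.Re (g x))).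
    by apply: measurable_funD; exact: measurable_funM.
  by apply/funext => x; case: (f x); case: (g x).
Qed.

Lemma cmeasurable_cut (b : T -> bool) f : measurable_fun setT b -> cmeasurable f ->
  cmeasurable (fun x => if b x then f x else 0).
Proof.
move=> mb [fr fi]; split.
- under eq_fun do rewrite (fun_if (@complex.Re R)).
  exact: measurable_fun_ifT.
- under eq_fun do rewrite (fun_if (@complex.Im R)).
  exact: measurable_fun_ifT.
Qed.

Lemma cLnormE (p : R) f :
  cLnorm mu p f = ((\int[mu]_x (Normc.normc (f x) `^ p)%:E) `^ p^-1)%E.
Proof.
rewrite /cLnorm unlock; congr (_ `^ _)%E; apply: eq_integral => x _.
by rewrite gee0_abs ?lee_fin ?normc_nneg// poweR_EFin.
Qed.

Lemma in_LpP (p : R) f : 0 < p -> in_Lp mu p f <->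
  cmeasurable f /\ (\int[mu]_x (Normc.normc (f x) `^ p)%:E < +oo)%E.
Proof.
move=> p0; rewrite /in_Lp cLnormE; split=> -[mf h]; split=> //.
  by apply: lty_poweRy h; rewrite gt_eqF ?invr_gt0.
exact: poweR_lty.
Qed.

Lemma cLnorm2_eq f g : cLnorm mu 2 f = cLnorm mu 2 g ->
  (\int[mu]_x (Normc.normc (f x) ^+ 2)%:E = \int[mu]_x (Normc.normc (g x) ^+ 2)%:E)%E.
Proof.
have sq h : ((cLnorm mu 2 h) `^ 2 = \int[mu]_x (Normc.normc (h x) ^+ 2)%:E)%E.
  rewrite cLnormE -poweRrM mulVf ?poweRe1//.
    by apply: eq_integral => x _; rewrite powR_mulrn ?normc_nneg.
  by apply: integral_ge0 => x _; rewrite lee_fin powR_ge0.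
by move=> fg; rewrite -!sq fg.
Qed.

(** The factor 2 arises from bounding the real and imaginary parts separately; it only affects the
    final constant. *)
Lemma normc_cintegral_le f g (M : R) : 0 <= M -> cmeasurable f -> in_Lp mu 1 g ->
  (forall x, Normc.normc (f x) <= M * Normc.normc (g x)) ->
  Normc.normc (cintegral mu f) <= 2 * M * fine (\int[mu]_x (Normc.normc (g x))%:E).
Proof.
move=> M0 [mr mi] /(in_LpP _ ltr01)[mg].
under eq_integral do rewrite powRr1 ?normc_nneg//.
move=> gfin fg; set G := (\int[mu]_x _)%E in gfin *.
have G0 : (0 <= G)%E by apply: integral_ge0 => x _; rewrite lee_fin normc_nneg.
have bound (h : T -> R) : measurable_fun setT h ->
    (forall x, `|h x| <= Normc.normc (f x)) -> `|\int[mu]_x h x| <= M * fine G.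
  move=> mh hf.
  have hG : (`|\int[mu]_x (h x)%:E| <= (M * fine G)%:E)%E.
    rewrite EFinM fineK ?ge0_fin_numE// -integral_EFinZ//; last 2 first.
    - exact: measurable_normc.
    - by move=> x; exact: normc_nneg.
    apply: le_trans (le_abse_integral _ _ _) _ => //; first exact/measurable_EFinP.
    apply: le_integral_EFin => //.
    - exact: measurableT_comp.
    - by apply: measurable_funM => //; exact: measurable_normc.
    - by move=> x; rewrite (le_trans (hf x)).
  (* The real-valued integral is [fine] of the extended one, so finiteness is needed to carry the
     bound over. *)
  have hfin : (\int[mu]_x (h x)%:E \is a fin_num)%E.
    by rewrite fin_num_abs (le_lt_trans hG) ?ltry.
  by rewrite -lee_fin /Rintegral -abse_EFin fineK.
apply: le_trans (normc_le_ReDIm _) _; rewrite /cintegral/=.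
have -> : 2 * M * fine G = M * fine G + M * fine G by ring.
apply: lerD; apply: bound => //.
- by move=> x; exact: normc_Re_le.
- by move=> x; exact: normc_Im_le.
Qed.

End complex_functions.

(** * Cutting a function at a height, for operators bounded on L^1 and L^2 *)

Section paley_operator.
Context d (T : measurableType d) {R : realType}.
Variable mu : {measure set T -> \bar R}.
Implicit Types (f : T -> R[i]) (psi : T -> R).

(* [F h] depends on [h] only up to a null set, so the splitting
   [F f = F f1 + F f2] and the bound on [F f1] hold off a null set that depends
   on the height of the cut. *)
Lemma paley_operator (F : (T -> R[i]) -> (T -> R[i])) (p K M : R) psi f :
  1 < p -> p < 2 -> 0 <= K -> 0 < M ->
  linear_on_Lp mu p F ->
  (forall h, in_Lp mu p h -> cmeasurable (F h)) ->
  (forall h, in_Lp mu 1 h -> {ae mu, forall xi,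
     Normc.normc (F h xi) <= K * fine (\int[mu]_x (Normc.normc (h x))%:E)}) ->
  (forall h, in_Lp mu 2 h -> cmeasurable (F h) ->
     (\int[mu]_x (Normc.normc (F h x) ^+ 2)%:E <=
      \int[mu]_x (Normc.normc (h x) ^+ 2)%:E)%E) ->
  measurable_fun setT psi -> (forall x, 0 < psi x) ->
  (forall t : R, 0 < t -> (t%:E * mu [set x | (t <= psi x)%R] <= M%:E)%E) ->
  in_Lp mu p f ->
  (\int[mu]_x (Normc.normc (F f x) `^ p * psi x `^ (2 - p))%:E <=
   (paley_cst p K * M `^ (2 - p))%:E * \int[mu]_x (Normc.normc (f x) `^ p)%:E)%E.
Proof.
move=> p1 p2 K0 M0 linF mF F1 F2 mpsi psi0 wk fp.
have p0 : 0 < p by lra.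
have [mf ffin] := (in_LpP mu f p0).1 fp.
have mu_ := measurable_normc mf.
have nn (z : R[i]) : 0 <= Normc.normc z by exact: normc_nneg.
have mg := measurable_normc (mF _ fp).
have psiM0 x : 0 < M^-1 * psi x by rewrite mulr_gt0 ?invr_gt0.
have mpsiM : measurable_fun setT (fun x => M^-1 * psi x) by exact: measurable_funM.
have -> : (\int[mu]_x (Normc.normc (F f x) `^ p * psi x `^ (2 - p))%:E =
    (M `^ (2 - p))%:E *
    \int[mu]_x (Normc.normc (F f x) `^ p * (M^-1 * psi x) `^ (2 - p))%:E)%E.
  rewrite -integral_EFinZ ?powR_ge0//; last 2 first.
  - by apply: measurable_funM; exact: measurable_powR_fun.
  - by move=> x; rewrite mulr_ge0 ?powR_ge0.
  apply: eq_integral => x _; congr EFin; rewrite mulrCA -powRM ?(ltW M0) ?(ltW (psiM0 _))//.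
  by rewrite mulVKf ?gt_eqF.
rewrite [(_ * M `^ _)%R]mulrC EFinM -muleA lee_wpmul2l ?lee_fin ?powR_ge0//.
apply: paley_interpolation => // [t t0|s s0].
  have -> : [set x | t <= M^-1 * psi x] = [set x | t * M <= psi x].
    by apply/funext => x; rewrite /mkset [M^-1 * _]mulrC ler_pdivlMr.
  have := wk _ (mulr_gt0 t0 M0); rewrite [t * M]mulrC EFinM -muleA.
  rewrite -[X in (_ <= X -> _)%E](mule1 M%:E) lee_pmul2l ?lte_fin//.
pose f1 x := if s < Normc.normc (f x) then f x else 0.
pose f2 x := if Normc.normc (f x) <= s then f x else 0.
have n1 x : Normc.normc (f1 x) = Normc.normc (f x) * (s < Normc.normc (f x))%R%:R.
  by rewrite /f1; case: ifP => _; rewrite ?mulr1 ?mulr0 ?Normc.normc0.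
have n2 x : Normc.normc (f2 x) = Normc.normc (f x) * (Normc.normc (f x) <= s)%R%:R.
  by rewrite /f2; case: ifP => _; rewrite ?mulr1 ?mulr0 ?Normc.normc0.
have mf1 : cmeasurable f1 by apply: cmeasurable_cut => //; exact: measurable_fun_ltr.
have mf2 : cmeasurable f2 by apply: cmeasurable_cut => //; exact: measurable_fun_ler.
have in_Lr r h (C : R) : 0 < r -> 0 <= C -> cmeasurable h ->
    (forall x, Normc.normc (h x) `^ r <= C * Normc.normc (f x) `^ p) -> in_Lp mu r h.
  move=> r0 C0 mh hf; apply/in_LpP => //; split => //.
  apply: (@le_lt_trans _ _ (C%:E * \int[mu]_x (Normc.normc (f x) `^ p)%:E)%E).
    rewrite -integral_EFinZ//; last 2 first.
    - exact: measurable_powR_fun.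
    - by move=> x; exact: powR_ge0.
    apply: le_integral_EFin => //.
    - exact/measurable_powR_fun/measurable_normc.
    - by apply: measurable_funM => //; exact: measurable_powR_fun.
    - by move=> x; exact: powR_ge0.
  by rewrite lte_mul_pinfty// lee_fin.
have f1p : in_Lp mu p f1.
  apply: (in_Lr _ _ 1) => // x; rewrite mul1r /f1; case: ifP => // _.
  by rewrite Normc.normc0 powR0 ?gt_eqF// powR_ge0.
have f2p : in_Lp mu p f2.
  apply: (in_Lr _ _ 1) => // x; rewrite mul1r /f2; case: ifP => // _.
  by rewrite Normc.normc0 powR0 ?gt_eqF// powR_ge0.
(* Where [|f| > s], [p > 1] gives [|f| <= s]^ (1 - p) * |f| [^ p]. *)
have f11 : in_Lp mu 1 f1.
  apply: (in_Lr _ _ (s `^ (1 - p))) => // [|x]; first exact: powR_ge0.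
  rewrite powRr1// n1; have [su|_] := ltP s _; last by rewrite mulr0 mulr_ge0 ?powR_ge0.
  rewrite mulr1 -{1}(mulr_powRB1 (nn (f x)) p0) mulrCA ler_peMr//.
  rewrite -opprB powRN mulrC ler_pdivlMr ?powR_gt0// mul1r.
  by apply: ge0_ler_powR; rewrite ?nnegrE ?subr_ge0// ltW.
(* Where [|f| <= s], [p < 2] gives [|f| ^ 2 <= s]^ (2 - p) * |f| [^ p]. *)
have f22 : in_Lp mu 2 f2.
  apply: (in_Lr _ _ (s `^ (2 - p))) => // [|x]; first exact: powR_ge0.
  have [->|fx] := eqVneq (Normc.normc (f2 x)) 0.
    by rewrite powR0// mulr_ge0 ?powR_ge0.
  move: fx; rewrite n2; have [us|_] := leP _ s; last by rewrite mulr0 eqxx.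
  rewrite mulr1 => fx; rewrite -{1}(subrK p 2) powRD ?fx ?implybT//.
  rewrite ler_wpM2r ?powR_ge0//.
  by apply: ge0_ler_powR; rewrite ?nnegrE ?subr_ge0// ltW.
have mFf2 := mF _ f2p.
(* The bounded part is the L^1 to L^infinity estimate of [F f1]; the other part is [|F f2|],
   controlled in L^2. *)
exists (K * fine (\int[mu]_x (Normc.normc (f1 x))%:E)),
  (fun x => Normc.normc (F f2 x)); split.
- by rewrite mulr_ge0// fine_ge0// integral_ge0// => x _; rewrite lee_fin.
- by split; [exact: measurable_normc|move=> x; exact: nn].
- apply: filterS2 (linF 1 f1 f2 f1p f2p) (F1 _ f11) => x.
  rewrite (_ : (fun x0 => 1 * f1 x0 + f2 x0) = f); last first.
    apply/funext => y; rewrite /f1 /f2 mul1r.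
    by case: leP => _; rewrite ?addr0 ?add0r.
  move=> -> F1x; rewrite mul1r; apply: le_trans (le_normcD _ _) _.
  by rewrite /= lerD2r.
- under [X in (_ <= _ * X)%E]eq_integral do rewrite -n1.
  rewrite EFinM fineK// ge0_fin_numE; last by apply: integral_ge0 => x _; rewrite lee_fin.
  have [_] := (in_LpP mu f1 ltr01).1 f11.
  by under eq_integral do rewrite powRr1 ?normc_nneg//.
- have := F2 _ f22 mFf2.
  under [X in (_ <= X)%E -> _]eq_integral do rewrite n2 exprMn.
  (* An indicator equals its square, which matches the squared modulus of [f2]. *)
  under [X in _ -> (_ <= X)%E]eq_integral.
    move=> x _; rewrite (_ : _%:R = (Normc.normc (f x) <= s)%R%:R ^+ 2); last first.
      by case: (_ <= _); rewrite ?expr1n ?expr0n.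
    over.
  by [].
Qed.

End paley_operator.

(** * Endpoint bounds for the transform, and the weak constant *)

Section ka_fourier_bounds.
Context {R : realType} {N : nat}.
Local Notation V := 'rV[R]_N.
Variables (Rt Rp : {fset V}) (k : V -> R) (a : R) (c : R[i]).
Variables (B : V -> V -> R[i]) (F : (V -> R[i]) -> V -> R[i]).
Hypothesis hF : is_ka_fourier Rt Rp k a c B F.
Local Notation mu := (ka_measure Rt k a).

(** [F h] is otherwise known only up to almost everywhere equality, which by itself does not
    transfer measurability; the Hausdorff-Young clause supplies it. *)
Lemma ka_fourier_cmeasurable p h : 1 < p <= 2 -> in_Lp mu p h -> cmeasurable (F h).
Proof.
by move=> hp hLp; case: hF => _ _ _ /(_ p hp)[C /(_ h hLp)[[]]].
Qed.

(** Almost everywhere, [F h] is [U h] times a phase of modulus 1, and [U] preserves the L^2 norm. *)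
Lemma ka_fourier_plancherel h : in_Lp mu 2 h ->
  (\int[mu]_x (Normc.normc (F h x) ^+ 2)%:E =
   \int[mu]_x (Normc.normc (h x) ^+ 2)%:E)%E.
Proof.
move=> h2; have mFh : cmeasurable (F h).
  by apply: ka_fourier_cmeasurable h2; rewrite lexx ltr1n.
case: hF => -[U [[_ isoU _] _] FU] _ _ _.
have [[mU _] /cLnorm2_eq <-] := isoU _ h2.
apply: ae_eq_integral => //.
- exact/measurable_EFinP/measurable_funX/measurable_normc.
- exact/measurable_EFinP/measurable_funX/measurable_normc.
- by apply: filterS (FU _ h2) => x -> _; rewrite Normc.normcM normc_expi mul1r.
Qed.

Lemma ka_fourier_L1_bound (M : R) h : cmeasurable (fun z : V * V => B z.1 z.2) ->
  (forall xi x, Normc.normc (B xi x) <= M) -> in_Lp mu 1 h ->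
  {ae mu, forall xi, Normc.normc (F h xi) <=
    Normc.normc c * (2 * M) * fine (\int[mu]_x (Normc.normc (h x))%:E)}.
Proof.
move=> [mBr mBi] BM h1; case: hF => _ /(_ h h1) FB _ _.
apply: filterS FB => xi ->; rewrite Normc.normcM -mulrA ler_wpM2l ?normc_nneg//.
have mB : cmeasurable (B xi).
  split; first exact: (measurableT_comp mBr (pair1_measurable xi)).
  exact: (measurableT_comp mBi (pair1_measurable xi)).
apply: normc_cintegral_le => //.
(* Nonnegativity of [M] is read off from any value of the kernel. *)
- exact: le_trans (normc_nneg _) (BM xi xi).
- by apply: cmeasurableM => //; exact: h1.1.
- by move=> x; rewrite Normc.normcM ler_wpM2r ?normc_nneg.
Qed.

Lemma le_weak_const (psi : V -> R) t : 0 < t ->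
  (t%:E * mu [set xi | (t <= psi xi)%R] <= weak_const Rt k a psi)%E.
Proof. by move=> t0; apply: ereal_sup_ubound; exists t. Qed.

Lemma weak_const_ge0 (psi : V -> R) : (0 <= weak_const Rt k a psi)%E.
Proof. by apply: le_trans (le_weak_const psi ltr01); rewrite mul1e. Qed.

(** Every superlevel set of [psi] at a positive height is null, and those at heights [1 / (n + 1)]
    exhaust the space because [psi > 0]. *)
Lemma weak_const0 (psi : V -> R) : measurable_fun setT psi -> (forall xi, 0 < psi xi) ->
  weak_const Rt k a psi = 0%E -> mu setT = 0%E.
Proof.
move=> mpsi psi0 w0; apply/negligibleP => //.
have -> : [set: V] = \bigcup_n [set x | n.+1%:R^-1 <= psi x].
  apply/esym; rewrite -subTset => x _; exists (Num.bound (psi x)^-1) => //=.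
  rewrite -[leRHS]invrK lef_pV2 ?posrE ?invr_gt0//.
  rewrite (le_trans (ltW (archi_boundP _)))// ?ler_nat// invr_ge0 ltW//.
apply: negligible_bigcup => n; apply/negligibleP; first exact: measurable_superlevel.
apply/eqP; rewrite eq_le measure_ge0 andbT.
rewrite -(@lee_pmul2l _ (n.+1%:R^-1)%:E) ?lte_fin//.
by rewrite mule0 -[X in (_ <= X)%E]w0 le_weak_const.
Qed.

End ka_fourier_bounds.

(** * The Paley inequality for the generalised Fourier transform *)

Unset Implicit Arguments.

Theorem theorem2p1 (R : realType) (N : nat) (Rt Rp : {fset 'rV[R]_N})
    (k : 'rV[R]_N -> R) (a : R) (c : R[i])
    (B : 'rV[R]_N -> 'rV[R]_N -> R[i])
    (F : ('rV[R]_N -> R[i]) -> ('rV[R]_N -> R[i])) (p : R)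
    (hN : (1 <= N)%N)
    (hRt : is_root_system Rt) (hRp : is_positive_subsystem Rt Rp)
    (hk : is_multiplicity Rt k) (ha : 0 < a)
    (hka : 0 < a + 2 * ksum Rt k + N%:R - 2)
    (hB : is_bounded_kernel B)
    (hF : is_ka_fourier Rt Rp k a c B F)
    (hp : 1 < p <= 2) :
  exists2 C : R, 0 < C &
    forall psi : 'rV[R]_N -> R,
      measurable_fun setT psi -> (forall xi, 0 < psi xi) ->
      (weak_const Rt k a psi < +oo)%E ->
      forall f : 'rV[R]_N -> R[i], in_Lp (ka_measure Rt k a) p f ->
        ((\int[ka_measure Rt k a]_xi
            (Normc.normc (F f xi) `^ p * psi xi `^ (2 - p))%:E) `^ p^-1
         <= C%:E * weak_const Rt k a psi `^ ((2 - p) / p)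
            * cLnorm (ka_measure Rt k a) p f)%E.
Proof.
set mu := ka_measure Rt k a.
have /andP[p1 p2] := hp; have p0 : 0 < p by lra.
have [pE|pn2] := eqVneq p 2.
  (* At [p = 2] both powers with exponent [2 - p] equal 1, and the claim is Plancherel with constant
     1. *)
  exists 1 => // psi _ _ _ f; rewrite pE => f2.
  rewrite subrr mul0r poweRe0 !mul1e cLnormE le_eqVlt; apply/orP; left; apply/eqP.
  congr (_ `^ _)%E.
  under [LHS]eq_integral do rewrite powRr0 mulr1 powR_mulrn ?normc_nneg//.
  under [RHS]eq_integral do rewrite powR_mulrn ?normc_nneg//.
  exact: (ka_fourier_plancherel hF f2).
have {}p2 : p < 2 by rewrite lt_neqAle pn2.
case: hB => mB _ [M BM].
pose K := Normc.normc c * (2 * M).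
have K0 : 0 <= K.
  rewrite mulr_ge0 ?normc_nneg// mulr_ge0//.
  exact: le_trans (normc_nneg _) (BM 0 0).
have C0 := paley_cst_gt0 p1 p2 K0.
exists (paley_cst p K `^ p^-1) => [|psi mpsi psi0 wlty f fp]; first exact: powR_gt0.
(* A zero weak constant cannot be divided out; then the measure is zero and the left side
   vanishes. *)
have [w0|wn0] := eqVneq (weak_const Rt k a psi) 0%E.
  have mI : measurable_fun setT
      (fun xi => (Normc.normc (F f xi) `^ p * psi xi `^ (2 - p))%:E).
    apply/measurable_EFinP/measurable_funM; last exact: measurable_powR_fun.
    exact/measurable_powR_fun/measurable_normc/(ka_fourier_cmeasurable hF hp).
  have muT := weak_const0 mpsi psi0 w0.
  rewrite (ge0_negligible_integral measurableT measurableT mI _ muT).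
    rewrite setDv integral_set0 poweR0r ?invr_eq0 ?gt_eqF//.
    by rewrite !mule_ge0 ?poweR_ge0 ?lee_fin ?powR_ge0// cLnormE poweR_ge0.
  by move=> x _; rewrite lee_fin mulr_ge0 ?powR_ge0.
have wge0 := weak_const_ge0 Rt k a psi.
have wfin : weak_const Rt k a psi \is a fin_num by rewrite ge0_fin_numE.
set W := fine (weak_const Rt k a psi).
have WE : weak_const Rt k a psi = W%:E by rewrite fineK.
have W0 : 0 < W by rewrite fine_gt0// lt_neqAle eq_sym wn0 wge0.
have linF : linear_on_Lp mu p F by case: hF => _ _ lin _; apply: lin; rewrite !ltW.
have key : (\int[mu]_xi (Normc.normc (F f xi) `^ p * psi xi `^ (2 - p))%:E <=
    (paley_cst p K * W `^ (2 - p))%:E * \int[mu]_x (Normc.normc (f x) `^ p)%:E)%E.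
  apply: paley_operator => // [h hLp|h h1|h h2 _|t t0].
  - exact: (ka_fourier_cmeasurable hF hp hLp).
  - exact: (ka_fourier_L1_bound hF mB BM h1).
  - by rewrite (ka_fourier_plancherel hF h2).
  - by rewrite -WE le_weak_const.
(* The right side is gathered into one [p]-th root, so that [key] applies by monotonicity of the
   root. *)
rewrite cLnormE WE poweR_EFin powRrM -EFinM -powRM ?(ltW C0) ?powR_ge0//.
have I0 : (0 <= \int[mu]_x (Normc.normc (f x) `^ p)%:E)%E.
  by apply: integral_ge0 => x _; rewrite lee_fin powR_ge0.
rewrite -poweR_EFin -poweRM ?lee_fin ?(mulr_ge0 (ltW C0)) ?powR_ge0//.
apply: gt0_ler_poweR key; rewrite ?invr_ge0 ?(ltW p0)// in_itv/= leey andbT.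
  by apply: integral_ge0 => x _; rewrite lee_fin mulr_ge0 ?powR_ge0.
by rewrite mule_ge0// lee_fin (mulr_ge0 (ltW C0))// powR_ge0.
Qed.
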